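(* Let $n,p$ be positive integers with $p\le n/2$. Every nondeterministic OBDD (NOBDD) computing $\mathtt{MOD}^p_n$ has width at least $p$.
   Context: $\mathtt{MOD}^p_n:\{0,1\}^n\to\{0,1\}$ equals 1 iff the number of ones in the input is congruent to $0$ modulo $p$. An OBDD on variables $x_1,\dots,x_n$ is a directed acyclic graph with one source whose nodes are partitioned into levels $V_0,\dots,V_\ell$; nodes of $V_\ell$ are accepting or rejecting sinks; all nodes of $V_j$ ($j<\ell$) query the same variable and have edges labelled 0 and 1 only into $V_{j+1}$; each variable is queried at most once on every path. In a nondeterministic OBDD (NOBDD) a node may have several outgoing edges with the same label and an input is accepted iff some consistent path reaches an accepting sink; it computes $f$ if it accepts exactly $f^{-1}(1)$. The width is $\max_j|V_j|$. *)

(* Defs.v *)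
From mathcomp Require Import all_boot.

Set Implicit Arguments.
Unset Strict Implicit.
Unset Printing Implicit Defensive.

(* Acyclicity is not a separate field: every edge raises the level by one.    *)
(* [edge b u v] is an arbitrary relation for each label [b], so a node may    *)
(* have zero, one or several outgoing edges with label [b].                   *)
(* [var j] is meaningful only for [j < depth]: nodes of the last level are    *)
(* sinks and query nothing.                                                   *)
Record nobdd (n : nat) := Nobdd {
  node : finType;
  edge : bool -> rel node;
  depth : nat;
  level : node -> nat;
  var : nat -> 'I_n;
  source : node;
  accepting : {set node};
  level_le_depth : forall v, level v <= depth;
  level_nonempty : forall j, j <= depth -> exists v, level v = j;
  level_edge : forall b u v, edge b u v -> level v = (level u).+1;
  sourceP : forall v, (forall b u, ~~ edge b u v) <-> v = source;
  accepting_sink : forall v, v \in accepting -> level v = depth;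
  read_once : forall u s,
    path (fun v w => edge false v w || edge true v w) u s ->
    uniq [seq var (level v) | v <- u :: s & level v < depth]
}.

(* Follows the edges whose label is the input bit queried at their tail.      *)
Definition consistent n (D : nobdd n) (x : n.-tuple bool) : rel (node D) :=
  fun u v => edge (tnth x (var D (level u))) u v.

Definition accepts n (D : nobdd n) (x : n.-tuple bool) : Prop :=
  exists2 s, path (consistent x) (source D) s
           & last (source D) s \in accepting D.

Definition computes n (D : nobdd n) (f : n.-tuple bool -> bool) : Prop :=
  forall x, accepts D x <-> f x.

Definition width n (D : nobdd n) : nat :=
  \max_(j < (depth D).+1) #|[set v : node D | level v == j]|.

Definition MOD (p n : nat) (x : n.-tuple bool) : bool :=
  count id x == 0 %[mod p].

(* Main.v *)
Require Import Defs.
From mathcomp Require Import all_boot.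
From mathcomp Require Import zify.

Set Implicit Arguments.
Unset Strict Implicit.
Unset Printing Implicit Defensive.

(** The argument is a fooling set at level [p.-1]. Let [A] be the set of the
    [p.-1] variables queried above that level. For [i < p] let [x_i] have [i]
    ones inside [A] and [p - i] ones outside; it is accepted. If accepting paths
    of [x_i] and [x_j] met at level [p.-1], exchanging their tails would give an
    accepting path for an input with [i + (p - j)] ones, which forces [i = j].
    So these paths cross the level in [p] distinct nodes. *)

Section CharacteristicTuples.
Variable n : nat.

Definition char_tuple (S : {set 'I_n}) : n.-tuple bool :=
  [tuple i \in S | i < n].

Lemma tnth_char_tuple (S : {set 'I_n}) i : tnth (char_tuple S) i = (i \in S).
Proof. by rewrite tnth_mktuple. Qed.

Lemma count_char_tuple (S : {set 'I_n}) : count id (char_tuple S) = #|S|.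
Proof. by rewrite /= count_map cardE enumT -size_filter. Qed.

Lemma MOD_char_tuple p (S : {set 'I_n}) : MOD p (char_tuple S) = (p %| #|S|).
Proof. by rewrite /MOD count_char_tuple mod0n. Qed.

End CharacteristicTuples.

Lemma exists_subset_card (T : finType) (A : {set T}) k :
  k <= #|A| -> exists2 B : {set T}, B \subset A & #|B| = k.
Proof.
move=> le_kA; exists [set x in take k (enum A)].
  by apply/subsetP=> x; rewrite inE => /mem_take; rewrite mem_enum.
rewrite cardsE; have /card_uniqP -> := take_uniq k (enum_uniq A).
by rewrite size_take -cardE; case: ltngtP le_kA.
Qed.

Lemma card_setU_split (T : finType) (A B C : {set T}) :
  B \subset A -> C \subset ~: A -> #|B :|: C| = #|B| + #|C|.
Proof.
move=> sBA sCA; rewrite cardsU disjoint_setI0 ?cards0 ?subn0 //.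
by rewrite disjoints_subset (subset_trans sBA) // subsetC.
Qed.

Lemma in_setU_inside (T : finType) (A B C : {set T}) x :
  C \subset ~: A -> x \in A -> (x \in B :|: C) = (x \in B).
Proof.
move=> /subsetP sCA xA; rewrite inE; case: (x \in B) => //=.
by apply/negbTE/negP=> /sCA; rewrite inE xA.
Qed.

Lemma in_setU_outside (T : finType) (A B C : {set T}) x :
  B \subset A -> x \notin A -> (x \in B :|: C) = (x \in C).
Proof. by rewrite setUC => sBA xA; rewrite (@in_setU_inside _ (~: A)) ?setCK ?inE. Qed.

Section NOBDD.
Variables (n : nat) (D : nobdd n).
Implicit Types (x y z : n.-tuple bool) (u v : node D) (s : seq (node D)).

(** Level 0 is inhabited, and a node there has no incoming edge because edges end on positive
    levels; only the source has that property. *)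
Lemma level_source : level (source D) = 0.
Proof.
have [v v0] := level_nonempty (leq0n (depth D)).
have <- // : v = source D.
by apply/sourceP => b u; apply/negP=> /level_edge; rewrite v0.
Qed.

Lemma map_level_path x u s : path (consistent x) u s ->
  map (@level n D) (u :: s) = iota (level u) (size s).+1.
Proof.
elim: s u => [|w s IHs] u //= /andP[/level_edge lw /IHs].
by rewrite /= => ->; rewrite lw.
Qed.

Lemma level_last_path x u s : path (consistent x) u s ->
  level (last u s) = level u + size s.
Proof.
elim: s u => [|w s IHs] u /=; first by rewrite addn0.
by case/andP=> /level_edge lw /IHs ->; rewrite lw addSnnS.
Qed.

Lemma accepting_path_size x s : path (consistent x) (source D) s ->
  last (source D) s \in accepting D -> size s = depth D.
Proof.
by move=> /level_last_path + /accepting_sink => ->; rewrite level_source.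
Qed.

(** Only tails of edges query a variable, so the level of the last node is excluded from the range
    of [k]. *)
Lemma consistent_path_ext x z u s :
  (forall k, level u <= k < level u + size s ->
     tnth x (var D k) = tnth z (var D k)) ->
  path (consistent x) u s -> path (consistent z) u s.
Proof.
elim: s u => [|w s IHs] u //= eq_xz /andP[uw ws]; apply/andP; split.
  by move: uw; rewrite /consistent eq_xz // leqnn /= -addSnnS leq_addr.
apply: IHs ws => k; rewrite (level_edge uw) addSnnS => /andP[/ltnW lk kl].
by rewrite eq_xz // lk kl.
Qed.

Lemma accepts_ext x z :
  (forall k, k < depth D -> tnth x (var D k) = tnth z (var D k)) ->
  accepts D x -> accepts D z.
Proof.
move=> eq_xz [s xs acc]; exists s => //; apply: (consistent_path_ext _ xs) => k.
by rewrite level_source (accepting_path_size xs acc) => /andP[_ /eq_xz].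
Qed.

Definition accepting_through x v :=
  exists s1 s2, [/\ path (consistent x) (source D) s1, last (source D) s1 = v,
    path (consistent x) v s2 & last v s2 \in accepting D].

(** Levels climb by one from 0 to [depth D] along an accepting path, so cutting it after [m] edges
    gives the node. *)
Lemma accepts_through x m : m <= depth D -> accepts D x ->
  exists2 v, level v = m & accepting_through x v.
Proof.
move=> le_md [s xs acc]; have sz := accepting_path_size xs acc.
move: xs acc sz; rewrite -{1 2}(cat_take_drop m s) cat_path last_cat.
move=> /andP[xs1 xs2] acc sz; exists (last (source D) (take m s)).
  by rewrite (level_last_path xs1) level_source size_takel ?sz.
by exists (take m s), (drop m s).
Qed.

Lemma accepting_through_exchange x y z v :
  accepting_through x v -> accepting_through y v ->
  (forall k, k < level v -> tnth x (var D k) = tnth z (var D k)) ->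
  (forall k, level v <= k < depth D -> tnth y (var D k) = tnth z (var D k)) ->
  accepts D z.
Proof.
move=> [s1 [_ [xs1 ls1 _ _]]] [_ [s2 [_ _ ys2 acc]]] eq_xz eq_yz.
exists (s1 ++ s2); last by rewrite last_cat ls1.
rewrite cat_path ls1; apply/andP; split.
  apply: (consistent_path_ext _ xs1) => k /andP[_].
  by rewrite -(level_last_path xs1) ls1 => /eq_xz.
apply: (consistent_path_ext _ ys2) => k.
by rewrite -(level_last_path ys2) (accepting_sink acc) => /eq_yz.
Qed.

(* [read_once] constrains paths only, so a full-length path is needed here. *)
Lemma var_inj x : accepts D x -> {in gtn (depth D) &, injective (var D)}.
Proof.
move=> [s xs acc]; apply/mkseq_uniqP.
have /read_once : path (fun v w => edge false v w || edge true v w) (source D) s.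
  apply: sub_path xs => v w; rewrite /consistent.
  by case: (tnth _ _) => ->; rewrite ?orbT.
rewrite (map_comp (var D)) -(filter_map _ (gtn (depth D))).
(* The path meets the levels 0 to [depth D] once each, and the filter drops only the final sink. *)
rewrite (map_level_path xs) level_source (accepting_path_size xs acc).
rewrite -addn1 iotaD filter_cat /= ltnn cats0 (eq_in_filter (a2 := predT)).
  by rewrite filter_predT.
by move=> k; rewrite mem_iota.
Qed.

Definition queried m : {set 'I_n} := [set i in mkseq (var D) m].

Lemma mem_queried k m : k < m -> var D k \in queried m.
Proof. by move=> ltkm; rewrite inE map_f // mem_iota. Qed.

(** The accepted input supplies the full-length path on which [var_inj] rests. *)
Lemma queried_notin x k m : accepts D x ->
  m <= k < depth D -> var D k \notin queried m.
Proof.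
move=> /var_inj inj /andP[le_mk lt_kd]; rewrite inE.
apply/mapP=> -[j]; rewrite mem_iota => /andP[_ lt_jm] /inj eq_kj.
by have := eq_kj lt_kd (leq_trans lt_jm (leq_trans le_mk (ltnW lt_kd))); lia.
Qed.

Lemma card_queried_le m : #|queried m| <= m.
Proof. by rewrite cardsE (leq_trans (card_size _)) // size_mkseq. Qed.

Lemma card_queried x m : accepts D x -> m <= depth D -> #|queried m| = m.
Proof.
move=> /var_inj inj le_md; rewrite cardsE.
have /card_uniqP -> : uniq (mkseq (var D) m); last by rewrite size_mkseq.
apply/mkseq_uniqP => i j lt_im lt_jm; apply: inj; rewrite !inE;
  exact: leq_trans le_md.
Qed.

Lemma card_level_le_width m : m <= depth D ->
  #|[set v : node D | level v == m]| <= width D.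
Proof.
rewrite -ltnS => lt_md.
exact: (leq_bigmax (F := fun j : 'I_(depth D).+1 =>
  #|[set v : node D | level v == j]|) (Ordinal lt_md)).
Qed.

Lemma MOD_accepts p (S : {set 'I_n}) : computes D (@MOD p n) ->
  accepts D (char_tuple S) <-> p %| #|S|.
Proof. by move=> hD; rewrite -MOD_char_tuple. Qed.

(** With fewer than [n] levels some variable is never queried. Setting it to 1 in the accepted
    all-zero input would go unnoticed, yet [p] does not divide 1. *)
Lemma MOD_depth_ge p : computes D (@MOD p n) -> 1 < p -> n <= depth D.
Proof.
move=> hD p_gt1; rewrite leqNgt; apply/negP=> lt_dn.
have /exists_subset_card[B sB cB] : 1 <= #|~: queried (depth D)|.
  have := cardsC (queried (depth D)); rewrite card_ord.
  by have := card_queried_le (depth D); lia.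
have /(MOD_accepts set0 hD) acc0 : p %| #|(set0 : {set 'I_n})| by rewrite cards0.
suff /(MOD_accepts B hD) : accepts D (char_tuple B) by rewrite cB dvdn1; lia.
apply: accepts_ext acc0 => k lt_kd; rewrite !tnth_char_tuple -(set0U B).
by rewrite (in_setU_inside _ sB) // mem_queried.
Qed.

End NOBDD.

Theorem theorem10 (n p : nat) (hn : 0 < n) (hp : 0 < p) (hpn : 2 * p <= n)
    (D : nobdd n) (hD : computes D (@MOD p n)) :
  p <= width D.
Proof.
(* The level of the fooling set exists: for [p = 1] it is level 0, otherwise the depth is at least
   [n]. *)
have le_md : p.-1 <= depth D.
  by have [/(MOD_depth_ge hD)|] := ltnP 1 p; lia.
have /(MOD_accepts set0 hD) acc0 : p %| #|(set0 : {set 'I_n})| by rewrite cards0.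
set A := queried D p.-1.
have cA : #|A| = p.-1 := card_queried acc0 le_md.
(* This is where [2 * p <= n] enters: the largest set needed outside [A], for [i = 0], has [p]
   elements. *)
have cAC : p <= #|~: A| by have := cardsC A; rewrite card_ord; lia.
have inside (i : 'I_p) : exists B : {set 'I_n}, B \subset A /\ #|B| = i.
  have [|B sB cB] := @exists_subset_card _ A i; last by exists B.
  by have := ltn_ord i; lia.
have outside (i : 'I_p) : exists C : {set 'I_n}, C \subset ~: A /\ #|C| = p - i.
  have [|C sC cC] := @exists_subset_card _ (~: A) (p - i); last by exists C.
  by lia.
have [B sB] := fin_all_exists inside; have [C sC] := fin_all_exists outside.
have cBC i j : #|B i :|: C j| = i + (p - j).
  have [sBA <-] := sB i; have [sCA <-] := sC j; exact: card_setU_split sBA sCA.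
have through (i : 'I_p) : exists v, level v = p.-1 /\
    accepting_through (D := D) (char_tuple (B i :|: C i)) v.
  have [|v lv tv] := @accepts_through n D (char_tuple (B i :|: C i)) _ le_md.
    by apply/(MOD_accepts _ hD); rewrite cBC subnKC // ltnW.
  by exists v.
have [f fP] := fin_all_exists through.
have dvd_exchange i j : f i = f j -> p %| i + (p - j).
  move=> eq_f; have [lv ti] := fP i; have [_] := fP j; rewrite -eq_f => tj.
  rewrite -cBC; apply/(MOD_accepts _ hD).
  (* The hybrid [B i :|: C j] agrees with [B i :|: C i] on [A] and with [B j :|: C j] off [A]. *)
  apply: (accepting_through_exchange ti tj) => k; rewrite lv !tnth_char_tuple.
    move=> /(mem_queried D) kA.
    by rewrite !(in_setU_inside _ _ kA) ?(proj1 (sC _)).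
  move=> /(queried_notin acc0) kA.
  by rewrite !(in_setU_outside _ _ kA) ?(proj1 (sB _)).
have f_inj : injective f.
  move=> i j eq_f; apply/val_inj => /=.
  have lt_ip := ltn_ord i; have lt_jp := ltn_ord j.
  have /dvdnP[q eq_q] := dvd_exchange i j eq_f.
  (* As [i, j < p], the sum [i + (p - j)] lies strictly between 0 and [2 * p], so the only multiple
     of [p] it can be is [p]. *)
  have q1 : q = 1 by nia.
  by move: eq_q; rewrite q1; lia.
rewrite -[p in p <= _]card_ord -cardsT -(card_imset _ f_inj).
apply: leq_trans (card_level_le_width le_md); apply/subset_leq_card/subsetP.
by move=> _ /imsetP[i _ ->]; rewrite inE (proj1 (fP i)).
Qed.
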